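(* For every positive integer $n$, $$v_{37}(a_n) = \begin{cases} \dfrac{n-s_{37}(n)}{36}, & \text{if } n\equiv 0 \pmod{37},\\[2mm] 1, & \text{if } n \equiv 25 \pmod{37},\\ 0, & \text{if } n \not\equiv 0, 25 \pmod{37}. \end{cases}$$ In particular, if $37\nmid n$ then $v_{37}(a_n)\leq 1$.
   Context: For a positive integer $n$, the Schenker sum is $a_n = \sum_{j=0}^{n}\frac{n!}{j!}n^j$. $v_{37}$ denotes the $37$-adic valuation, and $s_{37}(n)$ denotes the sum of the digits of $n$ in base $37$. *)

(* Defs.v *)
From mathcomp Require Import all_boot all_order all_algebra.

Set Implicit Arguments.
Unset Strict Implicit.
Unset Printing Implicit Defensive.

(* The quotient n`! %/ j`! is exact, since j <= n throughout the range. *)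
Definition schenker_sum (n : nat) : nat :=
  \sum_(0 <= j < n.+1) n`! %/ j`! * n ^ j.

(* For 1 < b and 0 < n, trunc_log b n is the position of the leading base-b
   digit of n, and the digit in position i is (n %/ b ^ i) %% b. *)
Definition digit_sum (b n : nat) : nat :=
  \sum_(0 <= i < (trunc_log b n).+1) (n %/ b ^ i) %% b.

(* Main.v *)
From Stdlib Require Import NArith.
Require Import Defs.
From mathcomp Require Import all_boot all_order all_algebra.
From mathcomp Require Import zify.

(** Reversing the summation index turns the Schenker sum into
    a_n = sum over i <= n of n^_i * n^(n - i), where n^_i is the falling
    factorial. The valuation is then found by two unrelated arguments.

    If a prime p divides n, the term n! (that of n^0) dominates: passing from
    n! to n!/j! * n^j loses v_p(j!) < j factors p and gains at least j of them,
    so all other terms are divisible by p^(v_p(n!) + 1) and v_p(a_n) = v_p(n!)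
    ([logn_schenker_sum_dvd]). Legendre's formula expresses v_p(n!) by digits
    ([legendre_digit_sum]).

    If p does not divide n, fix a power p^e. The falling factorials n^_i with
    i >= e * p vanish modulo p^e, so up to powers of the unit n the sum a_n is
    congruent to H(n), where
    H(x) = sum over i < e * p of x^_i * x^(e * p - 1 - i)
    is a fixed integer polynomial. Hence whether p^e divides a_n depends only
    on n modulo p^e ([dvdn_schenker_sum]). For p = 37 this leaves two finite
    verifications: for e = 1 the only nonzero root of H modulo 37 is 25, and for
    e = 2 none of the 37 lifts of 25 is a root modulo 37^2, so v_37(a_n) = 1
    when n = 25 modulo 37. *)

(** * Truncated falling sums *)

(** The number of terms k and the argument x are decoupled: a_n is the diagonal
    value at (n + 1, n), and at fixed k this is a polynomial in x. The exponent
    is k - 1 - i, so that every term has degree k - 1. *)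
Definition falling_sum (k x : nat) : nat :=
  \sum_(i < k) x ^_ i * x ^ (k.-1 - i).

Lemma falling_sumS k x :
  falling_sum k.+1 x = x * falling_sum k x + x ^_ k.
Proof.
rewrite /falling_sum big_ord_recr /= subnn expn0 muln1 big_distrr /=.
congr (_ + _); apply: eq_bigr => i _.
have -> : k - i = (k.-1 - i).+1 by have := ltn_ord i; lia.
by rewrite expnS mulnCA.
Qed.

Lemma schenker_sumE n : schenker_sum n = falling_sum n.+1 n.
Proof.
rewrite /schenker_sum /falling_sum big_mkord (reindex_inj rev_ord_inj) /=.
apply: eq_bigr => i _; rewrite subSS ffact_factd //.
by rewrite -ltnS.
Qed.

(** Once the falling factorials vanish modulo m, the recurrence
    [falling_sumS] only multiplies by x. *)
Lemma falling_sum_tail m k d x :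
    (forall i, k <= i -> m %| x ^_ i) ->
  falling_sum (k + d) x = x ^ d * falling_sum k x %[mod m].
Proof.
move=> m_dvd; elim: d => [|d IHd]; first by rewrite addn0 mul1n.
rewrite addnS falling_sumS expnS -mulnA.
rewrite -modnDmr (eqP (m_dvd _ (leq_addr d k))) addn0.
by rewrite -modnMmr IHd modnMmr.
Qed.

Lemma coprime_dvdn_falling_sum m k d x :
    coprime m x -> (forall i, k <= i -> m %| x ^_ i) ->
  (m %| falling_sum (k + d) x) = (m %| falling_sum k x).
Proof.
move=> co_mx /falling_sum_tail tail.
by rewrite /dvdn tail -/(dvdn _ _) Gauss_dvdr // coprimeXr.
Qed.

Lemma fact_dvd_fact m n : m <= n -> m`! %| n`!.
Proof. by move/bin_fact <-; rewrite mulnCA dvdn_mulr. Qed.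

(** The multiples p, 2p, ..., ep already supply e factors p. *)
Lemma expn_dvd_fact p e : 0 < p -> p ^ e %| (e * p)`!.
Proof.
move=> p_gt0; elim: e => [|e IHe]; first exact: dvd1n.
rewrite mulSn; have -> : p + e * p = (p.-1 + e * p).+1 by rewrite -addSn prednK.
rewrite factS expnS; apply: dvdn_mul.
  by rewrite -addSn prednK // dvdn_addr ?dvdn_mull.
by apply: dvdn_trans IHe _; apply: fact_dvd_fact; rewrite leq_addl.
Qed.

Lemma expn_dvd_ffact p e i x : 0 < p -> e * p <= i -> p ^ e %| x ^_ i.
Proof.
move=> p_gt0 le_i; rewrite -bin_ffact dvdn_mull //.
by apply: dvdn_trans (expn_dvd_fact p e p_gt0) (fact_dvd_fact _ _ le_i).
Qed.

(** Truncation does not break the congruence: when i exceeds x mod m, the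
    truncated product contains the factor 0, as the integer product does. *)
Lemma ffact_modn m i x : x ^_ i = (x %% m) ^_ i %[mod m].
Proof.
elim: i => [|i IHi] //; rewrite !ffactnSr.
have [lt_xi | le_ix] := ltnP (x %% m) i.
  by rewrite -modnMml IHi (ffact_small lt_xi) mod0n !mul0n mod0n.
rewrite -modnMml IHi modnMml -modnMmr -[in RHS]modnMmr.
congr (_ * _ %% _).
by rewrite {1}(divn_eq x m) -addnBA // modnMDl.
Qed.

Lemma falling_sum_modn m k x :
  falling_sum k x = falling_sum k (x %% m) %[mod m].
Proof.
elim: k => [|k IHk]; first by rewrite /falling_sum !big_ord0.
rewrite !falling_sumS -modnDm -[in RHS]modnDm ffact_modn; congr ((_ + _) %% _).
by rewrite -modnMml -modnMmr IHk modnMmr.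
Qed.

(** Both a_n, which has n + 1 terms, and the sum with e * p terms are compared
    with the sum having n + 1 + e * p terms: past n + 1 the falling factorials
    are 0, past e * p they are divisible by p^e. This treats n < e * p and
    n >= e * p alike. *)
Lemma dvdn_schenker_sum p e n : 0 < p -> coprime p n ->
  (p ^ e %| schenker_sum n)
    = (p ^ e %| falling_sum (e * p) (n %% p ^ e)).
Proof.
move=> p_gt0 co_pn.
have co_pe : coprime (p ^ e) n by rewrite coprimeXl.
rewrite schenker_sumE -(coprime_dvdn_falling_sum _ _ (e * p) _ co_pe) => [|i lt_ni].
  rewrite addnC coprime_dvdn_falling_sum // => [|i le_i]; last exact: expn_dvd_ffact.
  by rewrite /dvdn falling_sum_modn.
by rewrite ffact_small.
Qed.

(** * Evaluation of falling sums in binary *)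

(** The second component is the falling factorial of x of length k, carried
    along so that the recurrence [falling_sumS] costs two products per step.
    Subtraction on N is truncated like that on nat, so both sides agree also
    when k exceeds x. *)
Fixpoint falling_sumN (k : nat) (x : N) : N * N :=
  if k is k'.+1 then
    let: (s, f) := falling_sumN k' x in
    (N.add (N.mul x s) f, N.mul f (N.sub x (N.of_nat k')))
  else (N0, Npos xH).

Lemma falling_sumN_correct k x :
  (N.to_nat (falling_sumN k x).1 = falling_sum k (N.to_nat x))
  * (N.to_nat (falling_sumN k x).2 = (N.to_nat x) ^_ k).
Proof.
elim: k => [|k] /=; first by rewrite /falling_sum big_ord0 ffactn0.
case: (falling_sumN k x) => s f /= [IHs IHf].
by rewrite falling_sumS ffactnSr -IHs -IHf; split; lia.
Qed.

Definition dvdn_falling_sumN (m : N) (k r : nat) : bool :=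
  N.eqb (N.modulo (falling_sumN k (N.of_nat r)).1 m) N0.

Lemma dvdn_falling_sumNE m k r :
  (N.to_nat m %| falling_sum k r) = dvdn_falling_sumN m k r.
Proof.
have := (falling_sumN_correct k (N.of_nat r)).1; rewrite Nnat.Nat2N.id => <-.
rewrite /dvdn_falling_sumN; set s := (falling_sumN _ _).1.
apply/dvdnP/N.eqb_spec => [[q def_s]|/N.Lcm0.mod_divide[q ->]].
  by apply/N.Lcm0.mod_divide; exists (N.of_nat q); lia.
by exists (N.to_nat q); lia.
Qed.

(** * Legendre's formula with digit sums *)

Lemma legendre_digit_sum p n : prime p -> 0 < n ->
  p.-1 * logn p n`! + digit_sum p n = n.
Proof.
move=> p_pr n_gt0; have p_gt1 := prime_gt1 p_pr.
(* The digit in position i is q_i - p * q_(i + 1), where q_i = n %/ p ^ i. *)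
have telescope t : p.-1 * (\sum_(1 <= k < t.+1) n %/ p ^ k)
    + \sum_(0 <= i < t) (n %/ p ^ i) %% p + n %/ p ^ t = n.
  elim: t => [|t IHt].
    by rewrite !big_geq // expn0 divn1 muln0.
  rewrite big_nat_recr //= [X in _ + X + _]big_nat_recr //=.
  have := divn_eq (n %/ p ^ t) p; rewrite -divnMA -expnSr => def_q.
  have : n %/ p ^ t.+1 * p = p.-1 * (n %/ p ^ t.+1) + n %/ p ^ t.+1 by nia.
  by rewrite mulnDr; lia.
have lt_n : n < p ^ (trunc_log p n).+1 by apply: trunc_log_ltn.
have := telescope (trunc_log p n).+1.
rewrite (divn_small lt_n) addn0 /digit_sum => {4}<-.
congr (_ * _ + _); rewrite logn_fact //.
rewrite [in LHS](big_cat_nat (n := (trunc_log p n).+2)) //=; last first.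
  by rewrite !ltnS; apply: leq_trans (trunc_logP p_gt1 n_gt0); apply: ltn_expl.
rewrite [X in _ + X]big1_seq ?addn0 // => k /andP[_].
rewrite mem_index_iota => /andP[lt_tk _].
by rewrite divn_small // (leq_trans lt_n) // leq_exp2l // ltnW.
Qed.

(** * Schenker sums at multiples of a prime *)

(** By Legendre's formula, since the leading digit makes the digit sum
    positive. *)
Lemma logn_fact_lt p j : prime p -> 0 < j -> logn p j`! < j.
Proof.
move=> p_pr j_gt0; have p_gt1 := prime_gt1 p_pr.
have lead_gt0 : 0 < j %/ p ^ trunc_log p j.
  by rewrite divn_gt0 ?expn_gt0 ?trunc_logP //; lia.
have lead_lt : j %/ p ^ trunc_log p j < p.
  by rewrite ltn_divLR -?expnS ?trunc_log_ltn // expn_gt0; lia.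
have digits_gt0 : 0 < digit_sum p j.
  by rewrite /digit_sum big_nat_recr //= modn_small //; lia.
have := legendre_digit_sum p j p_pr j_gt0; nia.
Qed.

Lemma logn_schenker_sum_dvd p n : prime p -> 0 < n -> p %| n ->
  logn p (schenker_sum n) = logn p n`!.
Proof.
move=> p_pr n_gt0 p_dvd_n.
have tail_dvd : p ^ (logn p n`!).+1 %| \sum_(1 <= j < n.+1) n`! %/ j`! * n ^ j.
  rewrite big_seq; apply: dvdn_sum => j; rewrite mem_index_iota => /andP[j_gt0 le_jn].
  have quo_gt0 : 0 < n`! %/ j`!.
    by rewrite divn_gt0 ?fact_gt0 // dvdn_leq ?fact_gt0 ?fact_dvd_fact.
  rewrite pfactor_dvdn ?muln_gt0 ?quo_gt0 ?expn_gt0 ?n_gt0 //.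
  rewrite lognM ?expn_gt0 ?n_gt0 // lognX.
  rewrite -(divnK (fact_dvd_fact j n le_jn)) mulnK ?fact_gt0 // lognM ?fact_gt0 //.
  have := logn_fact_lt p j p_pr j_gt0.
  have : 0 < logn p n by rewrite logn_gt0 mem_primes p_pr n_gt0.
  nia.
have -> : schenker_sum n = n`! + \sum_(1 <= j < n.+1) n`! %/ j`! * n ^ j.
  by rewrite /schenker_sum big_ltn // fact0 divn1 expn0 muln1.
apply/eqP; rewrite eqn_leq leqNgt -!pfactor_dvdn ?addn_gt0 ?fact_gt0 //.
rewrite dvdn_addl // pfactor_dvdn ?fact_gt0 // ltnn /=.
by rewrite dvdn_addr ?pfactor_dvdnn // (dvdn_trans _ tail_dvd) // dvdn_exp2l.
Qed.

(** * The prime 37 *)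

Lemma falling_sum_residues_37 :
  all (fun r => dvdn_falling_sumN 37 37 r == (r == 25)) (iota 1 36).
Proof. by vm_compute. Qed.

(** All 37 values are congruent to 222 = 6 * 37 modulo 37^2: the derivative of
    the polynomial vanishes modulo 37 at the root 25, but its value there is not
    0 modulo 37^2, so Hensel lifting is obstructed. *)
Lemma falling_sum_residues_37_sqr :
  all (fun k => ~~ dvdn_falling_sumN 1369 74 (25 + k * 37)) (iota 0 37).
Proof. by vm_compute. Qed.

Lemma dvdn37_schenker_sum n : ~~ (37 %| n) ->
  (37 %| schenker_sum n) = (n %% 37 == 25).
Proof.
move=> ndvd_n; have := dvdn_schenker_sum 37 1 n.
rewrite expn1 mul1n prime_coprime // ndvd_n => -> //.
have -> : 37 = N.to_nat 37 by [].
rewrite dvdn_falling_sumNE; apply/eqP.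
apply: (allP falling_sum_residues_37); rewrite mem_iota.
by rewrite lt0n ndvd_n /= ltn_pmod.
Qed.

Lemma dvdn1369_schenker_sum n : n %% 37 = 25 -> ~~ (37 ^ 2 %| schenker_sum n).
Proof.
move=> n_mod; rewrite dvdn_schenker_sum //; last first.
  by rewrite prime_coprime // /dvdn n_mod.
have -> : n %% 37 ^ 2 = 25 + (n %% 37 ^ 2 %/ 37) * 37.
  rewrite {1}(divn_eq (n %% 37 ^ 2) 37) addnC; congr (_ + _).
  by rewrite modn_dvdm.
have -> : 37 ^ 2 = N.to_nat 1369 by vm_compute.
rewrite dvdn_falling_sumNE.
apply: (allP falling_sum_residues_37_sqr); rewrite mem_iota /=.
by rewrite ltn_divLR // ltn_pmod.
Qed.

Lemma logn37_schenker_sum n : ~~ (37 %| n) ->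
  logn 37 (schenker_sum n) = (n %% 37 == 25).
Proof.
move=> ndvd_n; have := dvdn37_schenker_sum n ndvd_n.
have n_gt0 : 0 < n by case: n ndvd_n.
have a_gt0 : 0 < schenker_sum n.
  by rewrite /schenker_sum big_ltn // fact0 divn1 muln1 addn_gt0 fact_gt0.
rewrite -{1}[37]expn1 pfactor_dvdn //.
case: eqP => [n_mod | _]; last by lia.
by have := dvdn1369_schenker_sum n n_mod; rewrite pfactor_dvdn //; lia.
Qed.

Import GRing.Theory.
Local Open Scope ring_scope.

Theorem mainTheorem3 (n : nat) (n_gt0 : (0 < n)%N) :
  ((logn 37 (schenker_sum n))%:R : rat) =
    (if (n == 0 %[mod 37])%N then (n%:R - (digit_sum 37 n)%:R) / 36%:R
     else if (n == 25 %[mod 37])%N then 1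
     else 0)
  /\ (~~ (37 %| n)%N -> (logn 37 (schenker_sum n) <= 1)%N).
Proof.
rewrite !mod0n -/(dvdn 37 n).
split=> [|/logn37_schenker_sum ->]; last exact: leq_b1.
case: ifPn => [dvd_n | /logn37_schenker_sum ->]; last by case: ifP.
rewrite logn_schenker_sum_dvd //.
rewrite -[in n%:R](legendre_digit_sum 37 n) // natrD addrK natrM.
by rewrite mulrC mulKf.
Qed.
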